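(* Let $q$ be a prime power, let $v=q^2+q+1$, and let $D=\{d_1,\dots,d_k\}\subseteq \mathbb{Z}/v\mathbb{Z}$ (with $k=q+1$) be a perfect difference set that is fixed by the multiplier $q$, i.e. $qD=D$. Let $P=\mathbb{Z}/v\mathbb{Z}$ be the set of points and $L=\{j+D : j\in\mathbb{Z}/v\mathbb{Z}\}$ the set of lines of the projective plane described by $D$ (incidence being membership), and let $\alpha:P\to L$ be given by $\alpha(j)=j+D$. Let $m=q$ or $m=q^2$, and for each $d_i\in D$ put $$\langle d_i, md_i, m^2d_i\rangle=\{(j,\; j+d_i,\; j+d_i+md_i) : j\in\mathbb{Z}/v\mathbb{Z}\}.$$ Then the set $$\mathscr{T}_{\mathrm{CMSZ}}=\bigcup_{i=1}^{k}\langle d_i, md_i, m^2d_i\rangle$$ is a triangle presentation over $P$ compatible with $\alpha$.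
   Context: Perfect difference set: a subset $D\subseteq\mathbb{Z}/v\mathbb{Z}$, $v=q^2+q+1$, with $|D|=q+1$, such that every nonzero element of $\mathbb{Z}/v\mathbb{Z}$ occurs exactly once among the differences $d-d'$ with $d,d'\in D$. The projective plane described by $D$: points are the elements of $\mathbb{Z}/v\mathbb{Z}$, lines are the shifts $j+D$, $j\in\mathbb{Z}/v\mathbb{Z}$, and a point is incident with a line if it belongs to it. Triangle presentation: let $P$ and $L$ be the sets of points and lines of a projective plane and let $\alpha:P\to L$ be a bijection. A set $\mathscr{T}$ of triples $(a,b,c)$ with $a,b,c\in P$ is a triangle presentation over $P$ compatible with $\alpha$ if: (1) given $a,b\in P$, one has $(a,b,c)\in\mathscr{T}$ for some $c\in P$ if and only if $b$ and $\alpha(a)$ are incident; (2) $(a,b,c)\in\mathscr{T}$ implies $(b,c,a)\in\mathscr{T}$; (3) given $a,b\in P$, one has $(a,b,c)\in\mathscr{T}$ for at most one $c\in P$. *)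

(* Defs.v *)
From mathcomp Require Import all_boot all_order all_algebra.

Set Implicit Arguments.
Unset Strict Implicit.
Unset Printing Implicit Defensive.

Import GRing.Theory.
Local Open Scope ring_scope.

Definition prime_power (q : nat) : Prop :=
  exists p k : nat, [/\ prime p, (0 < k)%N & q = (p ^ k)%N].

(* The last clause is nondegeneracy: four points, no three on a line. *)
Definition projective_plane (P L : Type) (inc : P -> L -> bool) : Prop :=
  [/\ forall a b : P, a <> b -> exists! l : L, inc a l /\ inc b l,
      forall l m : L, l <> m -> exists! a : P, inc a l /\ inc a m
    & exists f : 'I_4 -> P,
        injective f /\ forall l : L, (#|[set i | inc (f i) l]| <= 2)%N].

Definition triangle_presentation (P L : Type) (inc : P -> L -> bool)
    (alpha : P -> L) (T : {pred P * P * P}) : Prop :=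
  [/\ projective_plane inc,
      bijective alpha,
      forall a b : P, (exists c : P, (a, b, c) \in T) <-> inc b (alpha a),
      forall a b c : P, (a, b, c) \in T -> (b, c, a) \in T
    & forall a b c c' : P, (a, b, c) \in T -> (a, b, c') \in T -> c = c'].

(* 'Z_v is Z/vZ only for v >= 2, which v = q^2 + q + 1 with q > 0 ensures. *)
Definition perfect_difference_set (q v : nat) (D : {set 'Z_v}) : Prop :=
  [/\ v = (q ^ 2 + q + 1)%N,
      #|D| = (q + 1)%N
    & forall x : 'Z_v, x != 0 ->
        exists! p : 'Z_v * 'Z_v, [/\ p.1 \in D, p.2 \in D & p.1 - p.2 = x]].

Definition shift (v : nat) (D : {set 'Z_v}) (j : 'Z_v) : {set 'Z_v} :=
  [set j + d | d in D].

Definition shifts (v : nat) (D : {set 'Z_v}) : {set {set 'Z_v}} :=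
  [set shift D j | j : 'Z_v].

Definition line (v : nat) (D : {set 'Z_v}) : Type :=
  {l : {set 'Z_v} | l \in shifts D}.

Definition incident (v : nat) (D : {set 'Z_v}) (x : 'Z_v) (l : line D) : bool :=
  x \in sval l.

Lemma shift_in_shifts (v : nat) (D : {set 'Z_v}) (j : 'Z_v) :
  shift D j \in shifts D.
Proof. exact: imset_f. Qed.

Definition shift_line (v : nat) (D : {set 'Z_v}) (j : 'Z_v) : line D :=
  exist _ (shift D j) (shift_in_shifts D j).

(* <d, md, m^2 d>; the third step back to j is implied since
   1 + m + m^2 = 0 in Z/vZ for m = q and m = q^2. *)
Definition cmsz_block (v m : nat) (d : 'Z_v) : {set 'Z_v * 'Z_v * 'Z_v} :=
  [set (j, j + d, j + d + m%:R * d) | j : 'Z_v].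

Definition cmsz (v m : nat) (D : {set 'Z_v}) : {set 'Z_v * 'Z_v * 'Z_v} :=
  \bigcup_(d in D) cmsz_block m d.

(* Main.v *)
(* A triple (a, b, c) belongs to the CMSZ set iff b - a is in D and
   c = b + m (b - a), so c is determined by (a, b) and exists iff b lies in
   a + D.  Rotational invariance holds because D is stable under m and
   1 + m + m^2 = 0 in Z/vZ.  The plane axioms all come from the uniqueness of
   difference representations: two distinct points lie on a single shift, and
   two points taken on each of two distinct lines, away from their
   intersection, form a quadrangle. *)
Require Import Defs.
From mathcomp Require Import all_boot all_order all_algebra.
From mathcomp Require Import ring zify.
Import GRing.Theory.
Local Open Scope ring_scope.

Lemma prime_power_gt1 (q : nat) : prime_power q -> (1 < q)%N.
Proof.
case=> p [k [p_pr k_gt0 ->]].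
by rewrite -(exp1n k) ltn_exp2r // prime_gt1.
Qed.

Lemma mem_shift (v : nat) (D : {set 'Z_v}) (j x : 'Z_v) :
  (x \in shift D j) = (x - j \in D).
Proof.
apply/imsetP/idP => [[d dD ->]|xD]; first by rewrite addrAC subrr add0r.
by exists (x - j); rewrite // addrCA subrr addr0.
Qed.

Lemma card_shift (v : nat) (D : {set 'Z_v}) (j : 'Z_v) : #|shift D j| = #|D|.
Proof. by apply: card_imset; apply: addrI. Qed.

Lemma shift_lineP (v : nat) (D : {set 'Z_v}) (l : line D) :
  exists j : 'Z_v, l = shift_line D j.
Proof. by case: l => l lD; have /imsetP[j _ e] := lD; exists j; apply: val_inj. Qed.

Lemma mem_cmsz (v m : nat) (D : {set 'Z_v}) (a b c : 'Z_v) :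
  ((a, b, c) \in cmsz m D) = (b - a \in D) && (c == b + m%:R * (b - a)).
Proof.
apply/bigcupP/andP => [[d dD /imsetP[j _ [-> -> ->]]]|[abD /eqP->]].
  by rewrite [j + d - j]addrAC subrr add0r dD.
by exists (b - a) => //; apply/imsetP; exists a; rewrite // addrCA subrr addr0.
Qed.

Section PerfectDifferenceSet.

Variables (q v : nat) (D : {set 'Z_v}).
Hypotheses (q_gt1 : (1 < q)%N) (hD : perfect_difference_set q D).

(** The hypothesis [d1 != d2] excludes the difference 0, which every pair [(d, d)] represents. *)
Lemma difference_inj (d1 d2 e1 e2 : 'Z_v) :
    d1 \in D -> d2 \in D -> e1 \in D -> e2 \in D ->
  d1 != d2 -> d1 - d2 = e1 - e2 -> d1 = e1 /\ d2 = e2.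
Proof.
move=> d1D d2D e1D e2D; rewrite -subr_eq0 => dN0 eq_de.
have [_ _ /(_ _ dN0)[p [_ p_uniq]]] := hD.
by have [<- <-] : (d1, d2) = (e1, e2) by rewrite -(p_uniq (d1, d2)) // (p_uniq (e1, e2)).
Qed.

Lemma difference_exists (x : 'Z_v) : x != 0 ->
  exists d e : 'Z_v, [/\ d \in D, e \in D & d - e = x].
Proof. by move=> xN0; have [_ _ /(_ _ xN0)[[d e] [? _]]] := hD; exists d, e. Qed.

(** Both [(a - j, b - j)] and [(a - j', b - j')] represent the nonzero difference [a - b] in [D], so
    they agree. *)
Lemma shift_uniq (a b j j' : 'Z_v) : a != b ->
    a \in shift D j -> b \in shift D j ->
    a \in shift D j' -> b \in shift D j' ->
  j = j'.
Proof.
rewrite !mem_shift => ab aj bj aj' bj'.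
have [||/addrI/oppr_inj //] := difference_inj _ _ _ _ aj bj aj' bj'.
- by rewrite (inj_eq (addIr _)).
- by ring.
Qed.

(** A shift has q + 1 > 1 points, and two of them already determine its index. *)
Lemma shift_inj : injective (shift D).
Proof.
move=> j j' eq_jj'; have [_ cardD _] := hD.
have /card_gt1P[a [b [aj bj ab]]] : (1 < #|shift D j|)%N.
  by rewrite card_shift cardD addn1 ltnS ltnW.
by apply: (shift_uniq a b); rewrite // -eq_jj'.
Qed.

Lemma shift_line_bij : bijective (@shift_line v D).
Proof.
apply: inj_card_bij => [j j' /(congr1 sval)/shift_inj //|].
by rewrite card_sig -(card_imset _ shift_inj).
Qed.

(** Distinct shifts share at most one point, which leaves at least q > 1 of the q + 1 points. *)
Lemma card_shiftD_gt1 (j j' : 'Z_v) : j != j' ->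
  (1 < #|shift D j :\: shift D j'|)%N.
Proof.
move=> jj'; have [_ cardD _] := hD.
have : (#|shift D j :&: shift D j'| <= 1)%N.
  apply/card_le1_eqP => a b /setIP[aj aj'] /setIP[bj bj'].
  by apply: contraNeq jj' => ab; apply/eqP/(shift_uniq a b); rewrite // eq_sym.
have := cardsID (shift D j') (shift D j).
by rewrite card_shift cardD; lia.
Qed.

Lemma quadrangle_exists : exists f : 'I_4 -> 'Z_v,
  injective f /\ forall l : line D, (#|[set i | incident (f i) l]| <= 2)%N.
Proof.
have ne01 : (0 : 'Z_v) != 1 by rewrite eq_sym oner_neq0.
have /card_gt1P[a [b [/setDP[a0 a1] /setDP[b0 b1] ab]]] := card_shiftD_gt1 _ _ ne01.
rewrite eq_sym in ne01.
have /card_gt1P[c [d [/setDP[c1 c0] /setDP[d1 d0] cd]]] := card_shiftD_gt1 _ _ ne01.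
have neq x y j : x \in shift D j -> y \notin shift D j -> x != y.
  by move=> xj; apply: contraNneq => <-.
(* The only line through [x] and [y] is [shift D k], which misses [z]. *)
have only x y z j k : x != y -> x \in shift D k -> y \in shift D k ->
    z \notin shift D k -> ~~ [&& x \in shift D j, y \in shift D j & z \in shift D j].
  move=> xy xk yk; apply: contraNN => /and3P[xj yj zj].
  by rewrite (shift_uniq _ _ _ _ xy xk yk xj yj).
exists (fun i => nth 0 [:: a; b; c; d] i); split.
  move=> i i' /eqP; rewrite nth_uniq //; first by move/eqP/val_inj.
  by rewrite /= !inE !negb_or ab cd !(neq _ _ 0).
move=> l; have [j ->] := shift_lineP _ _ l.
rewrite -sum1dep_card big_mkcond !big_ord_recl big_ord0 /incident /=.
(* The four exclusions cover all 3-subsets of [a, b, c, d]; what remains is a check on four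
   booleans. *)
move: (only _ _ c j _ ab a0 b0 c0) (only _ _ d j _ ab a0 b0 d0).
move: (only _ _ a j _ cd c1 d1 a1) (only _ _ b j _ cd c1 d1 b1).
by do 4!case: (_ \in _).
Qed.

Lemma perfect_difference_set_plane : projective_plane (@incident v D).
Proof.
split; last exact: quadrangle_exists.
- move=> a b /eqP ab; have abN0 : a - b != 0 by rewrite subr_eq0.
  have [d [e [dD eD de]]] := difference_exists _ abN0.
  (* From [a - b = d - e] follows [a - d = b - e], the index of the joining line. *)
  have aj : a \in shift D (a - d) by rewrite mem_shift subKr.
  have bj : b \in shift D (a - d).
    rewrite mem_shift; suff -> : b - (a - d) = e by [].
    by rewrite -[d](subrK e) de; ring.
  exists (shift_line D (a - d)); split=> // l.
  have [j' ->] := shift_lineP _ _ l => -[aj' bj'].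
  by congr shift_line; apply: (shift_uniq a b).
- move=> l m; have [j ->] := shift_lineP _ _ l; have [j' ->] := shift_lineP _ _ m.
  move=> ne_jj'; have jj' : j != j' by apply/eqP => e; apply: ne_jj'; rewrite e.
  have j'jN0 : j' - j != 0 by rewrite subr_eq0 eq_sym.
  have [d [e [dD eD de]]] := difference_exists _ j'jN0.
  (* From [j' - j = d - e] follows [j + d = j' + e], the common point. *)
  have xj : j + d \in shift D j by rewrite mem_shift addrAC subrr add0r.
  have xj' : j + d \in shift D j'.
    rewrite mem_shift; suff -> : j + d - j' = e by [].
    by rewrite -[d](subrK e) de; ring.
  exists (j + d); split=> // x [yj yj'].
  apply/eqP; apply: contraNT jj' => xy; apply/eqP.
  exact: (shift_uniq _ _ _ _ xy).
Qed.

End PerfectDifferenceSet.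

(** The sum is v itself, reduced mod v. The bound [1 < v] matters because ['Z_v] has modulus 2 for
    smaller v. *)
Lemma sum_powers_q_Zp (q v : nat) : (0 < q)%N -> v = (q ^ 2 + q + 1)%N ->
  1 + q%:R + q%:R ^+ 2 = 0 :> 'Z_v.
Proof.
move=> q_gt0 ev; have v_gt1 : (1 < v)%N by rewrite ev; lia.
have <- : (q ^ 2 + q + 1)%:R = 0 :> 'Z_v by rewrite -ev pchar_Zp.
by rewrite !natrD natrX; ring.
Qed.

Theorem theorem2p4 (q v m : nat) (D : {set 'Z_v})
    (hq : prime_power q)
    (hv : v = (q ^ 2 + q + 1)%N)
    (hD : perfect_difference_set q D)
    (hmult : [set q%:R * d | d in D] = D)
    (hm : m = q \/ m = (q ^ 2)%N) :
  triangle_presentation (@incident v D) (@shift_line v D) (cmsz m D).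
Proof.
have q_gt1 := prime_power_gt1 _ hq.
have q_sum := sum_powers_q_Zp _ _ (ltnW q_gt1) hv.
have m_sum : 1 + m%:R + m%:R ^+ 2 = 0 :> 'Z_v.
  case: hm => -> //; rewrite natrX.
  (* For m = q^2, the factorization of 1 + x^2 + x^4 reduces the claim to the one for q. *)
  suff -> : 1 + q%:R ^+ 2 + q%:R ^+ 2 ^+ 2
      = (1 + q%:R + q%:R ^+ 2) * (1 - q%:R + q%:R ^+ 2) :> 'Z_v.
    by rewrite q_sum mul0r.
  by ring.
have qD d : d \in D -> q%:R * d \in D by move=> dD; rewrite -hmult imset_f.
have mD d : d \in D -> m%:R * d \in D.
  by case: hm => -> dD; rewrite ?natrX ?expr2 -?mulrA !qD.
split; [exact: perfect_difference_set_plane hD | exact: shift_line_bij hD | | |].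
- move=> a b; rewrite /incident /= mem_shift; split=> [[c]|abD].
    by rewrite mem_cmsz => /andP[].
  by exists (b + m%:R * (b - a)); rewrite mem_cmsz abD eqxx.
- move=> a b c; rewrite !mem_cmsz => /andP[abD /eqP->].
  rewrite [b + _ - b]addrAC subrr add0r mD //=; apply/eqP.
  (* With c = b + m(b - a), the rotated triple requires a = c + m(c - b): the steps b - a, m(b - a),
     m^2(b - a) must lead from a back to a. *)
  suff -> : b + m%:R * (b - a) + m%:R * (m%:R * (b - a))
      = (1 + m%:R + m%:R ^+ 2) * (b - a) + a by rewrite m_sum mul0r add0r.
  by ring.
- by move=> a b c c'; rewrite !mem_cmsz => /andP[_ /eqP->] /andP[_ /eqP->].
Qed.
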